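(* Consider the infinite server queue with stationary batch arrival rate $\lambda>0$, fixed batch size $n\in\mathbb{Z}^+$ and exponential service rate $\mu>0$, with number in system $Q_t(n)$. The moment generating function $\mathcal{M}_\infty(\theta)$ of the scaled number in system $Q_t(n)/n$ in steady-state as $n\to\infty$ (that is, $\mathcal{M}_\infty(\theta)=\lim_{t\to\infty}\lim_{n\to\infty}\mathbb{E}[e^{\theta Q_t(n)/n}]$) is given by $$\mathcal{M}_\infty(\theta)=\begin{cases}\theta^{-\frac{\lambda}{\mu}}e^{\frac{\lambda}{\mu}\left(\mathrm{Ei}(\theta)-\gamma\right)}&\text{if }\theta>0,\\(-\theta)^{-\frac{\lambda}{\mu}}e^{-\frac{\lambda}{\mu}\left(E_1(-\theta)+\gamma\right)}&\text{if }\theta<0,\\1&\text{if }\theta=0,\end{cases}$$ where $\gamma$ is the Euler-Mascheroni constant.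
   Context: Model: batches of exactly $n$ customers arrive at the epochs of a Poisson process of rate $\lambda$. There are infinitely many servers, so each customer starts service immediately and leaves after an independent $\mathrm{Exp}(\mu)$ service time. The number in system $Q_t(n)$ is thus the continuous-time Markov chain on $\{0,1,2,\dots\}$ with transitions $q\to q+n$ at rate $\lambda$ and $q\to q-1$ at rate $\mu q$. The initial number in system $Q_0$ is a fixed non-negative integer not depending on $n$. For $x>0$, $\mathrm{Ei}(x)=-\int_{-x}^\infty\frac{e^{-s}}{s}\,\mathrm{d}s$ (Cauchy principal value) and $E_1(x)=\int_x^\infty\frac{e^{-s}}{s}\,\mathrm{d}s$. *)

(* Defs.v *)
From HB Require Import structures.
From mathcomp Require Import all_boot all_order all_algebra.
From mathcomp Require Import all_classical all_reals all_analysis.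
Set Implicit Arguments.
Unset Strict Implicit.
Unset Printing Implicit Defensive.
Import Order.TTheory GRing.Theory Num.Theory.
Import numFieldNormedType.Exports.
Local Open Scope classical_set_scope.
Local Open Scope ring_scope.

(* [p t i j] is the probability of moving from i to j in time t; only t >= 0
   is meaningful. *)
Definition is_transition_function (R : realType) (p : R -> nat -> nat -> R) :=
  [/\ forall t i j, 0 <= t -> 0 <= p t i j,
      forall t i, 0 <= t -> series (p t i) @ \oo --> (1 : R),
      forall i j, p 0 i j = (i == j)%:R &
      forall s t i j, 0 <= s -> 0 <= t ->
        series (fun k => p s i k * p t k j) @ \oo --> p (s + t) i j].

Definition has_generator (R : realType) (p : R -> nat -> nat -> R)
    (G : nat -> nat -> R) :=
  forall i j, (p h i j - (i == j)%:R) / h @[h --> 0^'+] --> G i j.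

(* The history [H] is a finite list of pairs (past time, state at that time).
   Multiplying by the probability of the conditioning event avoids
   conditioning on null events. *)
Definition is_markov (R : realType) (d : measure_display)
    (T : measurableType d) (P : probability T R) (X : R -> {RV P >-> nat})
    (p : R -> nat -> nat -> R) :=
  forall (s t : R) (i j : nat) (H : seq (R * nat)), 0 <= s -> 0 <= t ->
    (forall u, u \in H -> 0 <= u.1 <= s) ->
    let A := [set w | X s w = i /\ forall u, u \in H -> X u.1 w = u.2] in
    P (A `&` [set w | X (s + t) w = j]) = (P A * (p t i j)%:E)%E.

Definition is_ctmc (R : realType) (d : measure_display)
    (T : measurableType d) (P : probability T R) (X : R -> {RV P >-> nat})
    (G : nat -> nat -> R) :=
  exists p : R -> nat -> nat -> R,
    [/\ is_transition_function p, has_generator p G & is_markov X p].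

(* Transition rates q -> q + n at rate lam and q -> q - 1 at rate mu * q, with
   minus the total rate on the diagonal. *)
Definition batch_generator (R : realType) (lam mu : R) (n : nat)
    (i j : nat) : R :=
  lam * (j == i + n)%N%:R + mu * i%:R * (j.+1 == i)%:R
  - (lam + mu * i%:R) * (j == i)%:R.

(* Number in system, as a process in t >= 0, of the infinite server queue with
   batches of n customers arriving at rate lam, Exp(mu) services, and q0
   customers at time 0. *)
Definition batch_infinite_server_queue (R : realType) (d : measure_display)
    (T : measurableType d) (P : probability T R) (lam mu : R) (n q0 : nat)
    (X : R -> {RV P >-> nat}) :=
  is_ctmc X (batch_generator lam mu n) /\ P [set w | X 0 w = q0] = 1%E.

Definition euler_mascheroni (R : realType) : R :=
  lim ((series harmonic n - ln n%:R : R) @[n --> \oo]).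

(* For x > 0, with the integral over [-x, +oo[ as a Cauchy principal value
   at 0. *)
Definition Ei (R : realType) (x : R) : R :=
  - lim ((Rintegral (@lebesgue_measure R) `[- x, - e] (fun s => expR (- s) / s)
        + Rintegral (@lebesgue_measure R) `[e, +oo[ (fun s => expR (- s) / s))
       @[e --> 0^'+]).

Definition E1 (R : realType) (x : R) : R :=
  Rintegral (@lebesgue_measure R) `[x, +oo[ (fun s => expR (- s) / s).

(* Main.v *)
Require Import Defs.
From HB Require Import structures.
From mathcomp Require Import all_boot all_order all_algebra.
From mathcomp Require Import all_classical all_reals all_analysis.
From mathcomp Require Import measurable_realfun ring lra zify.
Set Implicit Arguments.
Unset Strict Implicit.
Unset Printing Implicit Defensive.
Import Order.TTheory GRing.Theory Num.Theory.
Import numFieldNormedType.Exports.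
Local Open Scope classical_set_scope.
Local Open Scope ring_scope.

(** The law of the number in system is determined by Kolmogorov's backward
    equation. A transition function whose derivative at 0 is the generator
    satisfies this equation, in the sense of right derivatives
    (backward_equation), because the rows of the generator are finite and sum to
    zero. The candidate for the generating function of the queue started from i,
      a(t)^i exp ((lam / mu) sum_(1 <= k <= n) (z^k - a(t)^k) / k)
    with a(t) = 1 + (z - 1) e^(-mu t), satisfies it as well
    (queue_pgf_backward_solution). A minimum principle (minimum_principle)
    identifies the two: the partial sums of the true generating function are
    bounded solutions, and up to small multiples of the explicit solution for a
    larger z, which dominates at large states, they lie below the explicit
    solution and, when long enough, above it. Thus the convergence of the
    generating function for z > 1 is part of the conclusion (transition_pgf). The
    moment generating function of Q_t(n) / n is the case z = e^(theta / n)
    (queue_mgf).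

    With c = n (e^(theta / n) - 1), the sum in the exponent is
    Ein_n(c) - Ein_n(c e^(-mu t)), where
    Ein_n(x) = sum_(1 <= k <= n) ((1 + x / n)^k - 1) / k is the integral over
    [0, x] of ((1 + u / n)^n - 1) / u. It converges locally uniformly to
    Ein(x) = sum_(k >= 1) x^k / (k k!), the integral of (e^u - 1) / u
    (cvg_Ein_n). Since c tends to theta, the limit in n is
    M(t) = exp ((lam / mu) (Ein theta - Ein (theta e^(-mu t)))), and the limit in
    t is exp ((lam / mu) Ein theta).

    It remains to express Ein by the exponential integrals. Since
    ln |s| + Ein (- s) is an antiderivative of e^(-s) / s, this amounts to the
    limit of ln x + Ein (- x) at infinity, which is minus the Euler-Mascheroni
    constant (cvg_ln_Ein): Ein_n(- n) is minus the n-th harmonic number, and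
    Ein (- n) - Ein_n(- n) tends to 0. *)

(** * Transition functions *)

Section transition_function.
Variables (R : realType) (p : R -> nat -> nat -> R).
Hypothesis hp : is_transition_function p.

Lemma transition_ge0 t i j : 0 <= t -> 0 <= p t i j.
Proof. by case: hp => + _ _ _; exact. Qed.

Lemma transition_sum_le1 t i N : 0 <= t -> \sum_(0 <= k < N) p t i k <= 1.
Proof.
move=> t0; case: hp => _ /(_ t i t0) h1 _ _.
rewrite -(cvg_lim _ h1)//; apply: (nondecreasing_cvgn_le (u_ := series (p t i))).
- by apply: nondecreasing_series => k _ _; exact: transition_ge0.
- by apply/cvg_ex; exists 1.
Qed.

Lemma transition_le1 t i j : 0 <= t -> p t i j <= 1.
Proof.
move=> t0; apply: le_trans (transition_sum_le1 i j.+1 t0).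
rewrite big_nat_recr//= lerDr; apply: sumr_ge0 => k _; exact: transition_ge0.
Qed.

(** Truncating the Chapman-Kolmogorov sum at N costs at most the probability of
    jumping beyond N in the first period. *)
Lemma transition_truncation s t i j N : 0 <= s -> 0 <= t ->
  \sum_(0 <= k < N) p s i k * p t k j <= p (s + t) i j <=
  \sum_(0 <= k < N) p s i k * p t k j + (1 - \sum_(0 <= k < N) p s i k).
Proof.
move=> s0 t0; case: hp => _ _ _ /(_ s t i j s0 t0) h1.
have nd : nondecreasing_seq (series (fun k => p s i k * p t k j)).
  by apply: nondecreasing_series => k _ _; rewrite mulr_ge0// transition_ge0.
have cv : cvgn (series (fun k => p s i k * p t k j)).
  by apply/cvg_ex; exists (p (s + t) i j).
rewrite -(cvg_lim _ h1)//; apply/andP; split.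
  exact: (nondecreasing_cvgn_le nd).
apply: limr_le => //; exists N => // M /= NM.
rewrite /series/= (big_cat_nat (leq0n N) NM)//= lerD2l.
rewrite lerBrDl (le_trans _ (transition_sum_le1 i M s0))//.
rewrite [in leRHS](big_cat_nat (leq0n N) NM)//= lerD2l.
by apply: ler_sum => k _; rewrite ler_piMr ?transition_ge0 ?transition_le1.
Qed.

(** Both bounds of the truncation at i.+1 differ from p t i j by at most the
    probability of leaving i during the first period. *)
Lemma transition_dist s t i j : 0 <= s -> 0 <= t ->
  `|p (s + t) i j - p t i j| <= 1 - p s i i.
Proof.
move=> s0 t0; have /andP[h1 h2] := transition_truncation i j i.+1 s0 t0.
have p1 := transition_le1 i j t0; have p0 := transition_ge0 i j t0.
have q1 := transition_le1 i i s0; have q0 := transition_ge0 i i s0.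
move: h1 h2; rewrite !big_nat_recr//=.
have a0 : 0 <= \sum_(0 <= k < i) p s i k * p t k j.
  by apply: sumr_ge0 => k _; rewrite mulr_ge0// transition_ge0.
have ab : \sum_(0 <= k < i) p s i k * p t k j <= \sum_(0 <= k < i) p s i k.
  by apply: ler_sum => k _; rewrite ler_piMr ?transition_ge0 ?transition_le1.
move: a0 ab; move: (\sum_(_ <= _ < _) _) => a; move: (\sum_(_ <= _ < _) _) => b.
move=> a0 ab h1 h2; rewrite ler_norml; apply/andP; split; nra.
Qed.

Variable G : nat -> nat -> R.
Hypothesis hG : has_generator p G.

Lemma transition_diag_cvg i : p h i i @[h --> 0^'+] --> (1 : R).
Proof.
have : (p h i i - (i == i)%:R) / h * h + 1 @[h --> 0^'+] --> G i i * 0 + 1.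
  apply: cvgD; last exact: cvg_cst.
  by apply: cvgM; [exact: hG|exact: cvg_at_right_filter cvg_id].
rewrite mulr0 add0r; apply: cvg_trans; apply: near_eq_cvg.
near=> h; have h0 : 0 < h by near: h; exact: nbhs_right_gt.
by rewrite eqxx mulfVK ?subrK// gt_eqF.
Unshelve. all: by end_near. Qed.

Lemma transition_left_cvg i j t : 0 < t ->
  p s i j @[s --> t^'-] --> p t i j.
Proof.
move=> t0; have : 1 - p (t - s) i i @[s --> t^'-] --> (1 - 1 : R).
  apply: cvgB; first exact: cvg_cst.
  have : t - s @[s --> t^'-] --> 0^'+.
    move=> A A0; have A0' : \forall e \near 0^'+, A e by [].
    apply/(nbhs_left0P t (fun s => A (t - s))); apply: filterS A0' => e.
    by rewrite opprB addrC subrK.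
  by move=> ts; apply: (cvg_comp _ _ ts (transition_diag_cvg i)).
rewrite subrr => h0; apply/cvgrPdist_le => e e0.
move/cvgr0_norm_le : h0 => /(_ e e0); apply: filter_app; near=> s.
apply: le_trans; rewrite -{1}(subrK s t).
have st : s < t by near: s; exact: nbhs_left_lt.
apply: le_trans (ler_norm _); apply: transition_dist.
  by rewrite subr_ge0 ltW.
by rewrite ltW//; near: s; exact: nbhs_left_gt.
Unshelve. all: by end_near. Qed.

(** Kolmogorov's backward equation, as a right derivative. When the entries of
    a row of the generator that lie before N already sum to zero, the
    probability of jumping beyond N within time h is o(h), so that only finitely
    many terms of the Chapman-Kolmogorov sum matter. *)
Lemma backward_equation i j t N : 0 <= t -> (i < N)%N ->
  \sum_(0 <= k < N) G i k = 0 ->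
  (p (t + h) i j - p t i j) / h @[h --> 0^'+]
    --> \sum_(0 <= k < N) G i k * p t k j.
Proof.
move=> t0 iN G0.
have dlt (f : nat -> R) : \sum_(0 <= k < N) (i == k)%:R * f k = f i.
  rewrite (bigD1_seq i)/= ?mem_index_iota ?iota_uniq//= eqxx mul1r big1 ?addr0//.
  by move=> k /negPf; rewrite eq_sym => ->; rewrite mul0r.
have dlt1 : \sum_(0 <= k < N) (i == k)%:R = 1 :> R.
  by rewrite -[RHS](dlt (fun=> 1)); apply: eq_bigr => k _; rewrite mulr1.
pose lo h := \sum_(0 <= k < N) (p h i k - (i == k)%:R) / h * p t k j.
pose d h := \sum_(0 <= k < N) (p h i k - (i == k)%:R) / h.
have clo : lo h @[h --> 0^'+] --> \sum_(0 <= k < N) G i k * p t k j.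
  apply: cvg_big; first exact: add_continuous.
  by move=> k _; apply: cvgM; [exact: hG|exact: cvg_cst].
have cd : d h @[h --> 0^'+] --> \sum_(0 <= k < N) G i k.
  apply: cvg_big; first exact: add_continuous.
  by move=> k _; exact: hG.
have chi : lo h - d h @[h --> 0^'+] --> \sum_(0 <= k < N) G i k * p t k j.
  by rewrite -[X in _ --> X]subr0 -[X in _ - X]G0; exact: cvgB.
apply: (squeeze_cvgr _ clo chi); near=> h.
have h0 : 0 < h by near: h; exact: nbhs_right_gt.
have /andP[l u] := transition_truncation i j N (ltW h0) t0.
have -> : lo h = (\sum_(0 <= k < N) p h i k * p t k j - p t i j) / h.
  rewrite -[in RHS](dlt (fun k => p t k j)) -sumrB mulr_suml.
  by apply: eq_bigr => k _; rewrite mulrAC mulrBl.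
have -> : d h = (\sum_(0 <= k < N) p h i k - 1) / h.
  by rewrite -[in RHS]dlt1 -sumrB mulr_suml.
rewrite (addrC t) -mulrBl !ler_pM2r ?invr_gt0//; apply/andP; split; lra.
Unshelve. all: by end_near. Qed.

End transition_function.

(** * The minimum principle for the backward equation *)

Definition batch_op (R : realType) (lam mu : R) (n : nat) (f : nat -> R) i :=
  lam * (f (i + n)%N - f i) + mu * i%:R * (f i.-1 - f i).

(** Only right derivatives are available for a transition function a priori;
    together with left limits they suffice for an argument on the first time at
    which a solution becomes negative. *)
Definition backward_solution (R : realType) (lam mu : R) (n : nat)
    (w : R -> nat -> R) :=
  forall i t, 0 <= t ->
    (w (t + h) i - w t i) / h @[h --> 0^'+] --> batch_op lam mu n (w t) i /\
    (0 < t -> w s i @[s --> t^'-] --> w t i).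

Section minimum_principle.
Variables (R : realType) (lam mu : R) (n : nat).
Hypotheses (lam0 : 0 < lam) (mu0 : 0 < mu).
Implicit Types w : R -> nat -> R.

Lemma backward_solution_lin a b w1 w2 :
  backward_solution lam mu n w1 -> backward_solution lam mu n w2 ->
  backward_solution lam mu n (fun t i => a * w1 t i + b * w2 t i).
Proof.
move=> h1 h2 i t t0; have [d1 c1] := h1 i t t0; have [d2 c2] := h2 i t t0.
split=> [|tp]; last first.
  by apply: cvgD; apply: cvgMr; [exact: c1|exact: c2].
rewrite (_ : batch_op _ _ _ _ _ =
  a * batch_op lam mu n (w1 t) i + b * batch_op lam mu n (w2 t) i); last first.
  by rewrite /batch_op; ring.
rewrite (_ : (fun h => _) = (fun h => a * ((w1 (t + h) i - w1 t i) / h) +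
   b * ((w2 (t + h) i - w2 t i) / h))); last by apply/funext => h; ring.
by apply: cvgD; apply: cvgMr.
Qed.

(** The perturbation v = w + e (1 + t) satisfies v' = batch_op v + e. At the
    last time up to which v is nonnegative, a state below K where v vanishes has
    batch_op v >= 0, because the off-diagonal rates are nonnegative, hence
    v' >= e > 0 there; as there are finitely many states below K, v stays
    nonnegative a little longer. *)
Lemma minimum_principle w T K : backward_solution lam mu n w ->
  (forall i, 0 <= w 0 i) ->
  (forall t i, 0 <= t <= T -> (K <= i)%N -> 0 <= w t i) ->
  forall t i, 0 <= t <= T -> 0 <= w t i.
Proof.
move=> bw w0 wK.
suff key e : 0 < e -> forall t i, 0 <= t <= T -> 0 <= w t i + e * (1 + t).
  move=> t i tT; have /andP[t0 _] := tT; have t1 : 0 < 1 + t by lra.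
  apply/ler_addgt0Pr => e e0; have := key (e / (1 + t)) (divr_gt0 e0 t1) t i tT.
  by rewrite mulfVK// gt_eqF.
move=> e0; apply: contrapT => /existsNP[t1 /existsNP[i1]].
move=> /not_implyP[/andP[t10 t1T] /negP]; rewrite -ltNge => neg.
pose v t i := w t i + e * (1 + t); rewrite -/(v t1 i1) in neg.
pose S := [set t | 0 <= t <= T /\ exists i, v t i < 0].
have St1 : S t1 by split; [rewrite t10|exists i1].
have hS : has_inf S by split; [exists t1|exists 0 => t -[/andP[]]].
pose s := inf S.
have st1 : s <= t1 by apply: ge_inf => //; case: hS.
have s0 : 0 <= s by apply: lb_le_inf; [exists t1|move=> t -[/andP[]]].
have before t i : 0 <= t -> t < s -> 0 <= v t i.
  move=> t0 ts; rewrite leNgt; apply/negP => vneg.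
  suff : s <= t by rewrite leNgt ts.
  apply: ge_inf; first by case: hS.
  by split; [rewrite t0; lra|exists i].
have vs i : 0 <= v s i.
  have [->|sn0] := eqVneq s 0.
    by rewrite /v addr_ge0// mulr_ge0 ?ltW// addr0.
  have sp : 0 < s by rewrite lt_neqAle eq_sym sn0.
  have /(_ sp) c := (bw i s s0).2.
  have cv : v t i @[t --> s^'-] --> v s i.
    apply: cvgD; first exact: c.
    apply: cvgMr; apply: cvgD; first exact: cvg_cst.
    exact: cvg_at_left_filter cvg_id.
  apply: (cvgr_to_ge cv); near=> t; apply: before.
    by rewrite ltW//; near: t; exact: nbhs_left_gt.
  by near: t; exact: nbhs_left_lt.
have after i : \forall h \near 0^'+, 0 <= v (s + h) i.
  have [d _] := bw i s s0.
  have dv : (v (s + h) i - v s i) / h @[h --> 0^'+]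
      --> batch_op lam mu n (v s) i + e.
    rewrite (_ : batch_op _ _ _ (v s) i = batch_op lam mu n (w s) i); last first.
      by rewrite /batch_op /v; ring.
    have : (w (s + h) i - w s i) / h + e @[h --> 0^'+]
        --> batch_op lam mu n (w s) i + e by apply: cvgD => //; exact: cvg_cst.
    apply: cvg_trans; apply: near_eq_cvg; near=> h.
    have h0 : h != 0 by near: h; exact: nbhs_right_neq.
    by rewrite /v; field.
  have [vp|] := ltP 0 (v s i); last first.
    move=> vle; have vz : v s i = 0 by apply/eqP; rewrite eq_le vle vs.
    have bp : 0 < batch_op lam mu n (v s) i + e.
      rewrite ltr_wpDl// /batch_op vz !subr0 addr_ge0//.
        by rewrite mulr_ge0// ltW.
      by rewrite !mulr_ge0// ltW.
    near=> h; have h0 : 0 < h by near: h; exact: nbhs_right_gt.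
    have : 0 < (v (s + h) i - v s i) / h by near: h; exact: cvgr_gt dv _ bp.
    by rewrite vz subr0 pmulr_lgt0 ?invr_gt0// => /ltW.
  have : (v (s + h) i - v s i) / h * h + v s i @[h --> 0^'+]
      --> (batch_op lam mu n (v s) i + e) * 0 + v s i.
    apply: cvgD; last exact: cvg_cst.
    by apply: cvgM dv _; exact: cvg_at_right_filter cvg_id.
  rewrite mulr0 add0r => /cvgr_gt => /(_ _ vp) pos; near=> h.
  have h0 : h != 0 by near: h; exact: nbhs_right_neq.
  have : 0 < (v (s + h) i - v s i) / h * h + v s i by near: h; exact: pos.
  by rewrite mulfVK// subrK => /ltW.
have : \forall h \near 0^'+, forall i : 'I_K, 0 <= v (s + h) i.
  by apply: filter_forall => i; exact: after.
case=> r /= r0 rP; have [x [/andP[x0 xT] [i vx]] xs] := inf_adherent r0 hS.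
have sx : s <= x by apply: ge_inf; [case: hS|split; [rewrite x0|exists i]].
have sx' : s < x.
  rewrite lt_neqAle sx andbT; apply: contraTneq vx => <-.
  by rewrite -leNgt.
suff : 0 <= v x i by rewrite leNgt vx.
have [iK|Ki] := ltnP i K; last first.
  by rewrite addr_ge0 ?mulr_ge0 ?addr_ge0 ?wK ?(ltW e0)// x0.
have := rP (x - s); rewrite /= sub0r normrN ger0_norm ?subr_ge0// subr_gt0.
rewrite ltrBlDl => /(_ xs sx' (Ordinal iK)).
by rewrite addrC subrK.
Unshelve. all: by end_near. Qed.

End minimum_principle.

Section generator_action.
Variables (R : realType) (lam mu : R) (n : nat).
Hypothesis n0 : (0 < n)%N.

Lemma sum_batch_generator (f : nat -> R) i :
  \sum_(0 <= k < (i + n).+1) batch_generator lam mu n i k * f k =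
  batch_op lam mu n f i.
Proof.
have dlt a : (a < (i + n).+1)%N ->
    \sum_(0 <= k < (i + n).+1) (k == a)%:R * f k = f a.
  move=> aN; rewrite (bigD1_seq a) ?mem_index_iota ?iota_uniq//=.
  rewrite eqxx mul1r big1 ?addr0// => k /negPf ->.
  by rewrite mul0r.
rewrite (eq_bigr (fun k => lam * ((k == i + n)%N%:R * f k) +
    mu * (i%:R * ((k.+1 == i)%:R * f k)) -
    (lam + mu * i%:R) * ((k == i)%:R * f k))); last first.
  by move=> k _; rewrite /batch_generator; ring.
rewrite sumrB big_split/= -!mulr_sumr.
rewrite (dlt i) ?(dlt (i + n)%N) ?ltnS ?leq_addr//.
suff -> : i%:R * (\sum_(0 <= k < (i + n).+1) (k.+1 == i)%:R * f k) =
    i%:R * f i.-1 by rewrite /batch_op; ring.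
case: i dlt => [|i] dlt; first by rewrite !mul0r.
under eq_bigr do rewrite eqSS.
by rewrite dlt//; lia.
Qed.

(** The rows of the generator are finitely supported and sum to zero, so each
    column of the transition function solves the backward equation. *)
Lemma transition_backward_solution (p : R -> nat -> nat -> R) j :
  is_transition_function p -> has_generator p (batch_generator lam mu n) ->
  backward_solution lam mu n (fun t i => p t i j).
Proof.
move=> hp hG i t t0; split=> [|tp]; last exact: transition_left_cvg.
rewrite -sum_batch_generator; apply: backward_equation => //; first lia.
have := sum_batch_generator (fun=> 1) i; rewrite /batch_op !subrr !mulr0 addr0.
by under eq_bigr do rewrite mulr1.
Qed.

End generator_action.

(** * The generating function of the number in system *)

Lemma is_derive_at_right (R : realType) (f : R -> R) (t l : R) :
  is_derive t 1 f l -> (f (t + h) - f t) / h @[h --> 0^'+] --> l.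
Proof.
move=> [df <-]; have : h^-1 *: (f (h%:A + t) - f t) @[h --> 0^'] --> 'D_1 f t.
  exact: df.
move=> /cvg_dnbhs_at_right; apply: cvg_trans; apply: near_eq_cvg; near=> h.
by rewrite /GRing.scale/= mulr1 mulrC (addrC h).
Unshelve. all: by end_near. Qed.

Lemma is_derive_continuous (R : realType) (f : R -> R) (t l : R) :
  is_derive t 1 f l -> {for t, continuous f}.
Proof.
by move=> [df _]; exact/differentiable_continuous/derivable1_diffP.
Qed.

Lemma is_derive_pow (R : realType) (f : R -> R) (t l : R) m :
  is_derive t 1 f l -> is_derive t 1 (fun x => f x ^+ m) (m%:R * f t ^+ m.-1 * l).
Proof. by move=> d; have := is_deriveX m d; rewrite exprfctE. Qed.

Section explicit_solution.
Variables (R : realType) (lam mu : R) (n : nat).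
Hypotheses (lam0 : 0 < lam) (mu0 : 0 < mu).

(** The generating function, at z, of the indicator that a customer present at
    time 0 is still in service at time t. *)
Definition bernoulli_pgf (z t : R) := 1 + (z - 1) * expR (- (mu * t)).

(** The product of the contributions of the initial customers and of the
    arriving batches. The sum in the exponent is
    mu * int_0^t (bernoulli_pgf z s ^+ n - 1) ds in closed form, because
    bernoulli_pgf satisfies a' = mu (1 - a). *)
Definition queue_pgf (z t : R) (i : nat) :=
  bernoulli_pgf z t ^+ i *
  expR (lam / mu *
    \sum_(0 <= k < n) (z ^+ k.+1 - bernoulli_pgf z t ^+ k.+1) / k.+1%:R).

Lemma bernoulli_pgf0 z : bernoulli_pgf z 0 = z.
Proof. by rewrite /bernoulli_pgf mulr0 oppr0 expR0 mulr1 addrC subrK. Qed.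

Lemma bernoulli_pgf_gt0 z t : 0 < z -> 0 <= t -> 0 < bernoulli_pgf z t.
Proof.
move=> z0 t0; rewrite /bernoulli_pgf.
have : expR (- (mu * t)) <= 1 by rewrite expR_le1 oppr_le0 mulr_ge0// ltW.
by have := expR_gt0 (- (mu * t)); nra.
Qed.

Lemma bernoulli_pgf_le z t : 1 <= z -> 0 <= t -> bernoulli_pgf z t <= z.
Proof.
move=> z1 t0; rewrite /bernoulli_pgf.
have : expR (- (mu * t)) <= 1 by rewrite expR_le1 oppr_le0 mulr_ge0// ltW.
by have := expR_gt0 (- (mu * t)); nra.
Qed.

Lemma queue_pgf0 z i : queue_pgf z 0 i = z ^+ i.
Proof.
rewrite /queue_pgf bernoulli_pgf0 big1 ?mulr0 ?expR0 ?mulr1// => k _.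
by rewrite subrr mul0r.
Qed.

Lemma queue_pgf1 t i : queue_pgf 1 t i = 1.
Proof.
have a1 : bernoulli_pgf 1 t = 1 by rewrite /bernoulli_pgf subrr mul0r addr0.
rewrite /queue_pgf a1 expr1n big1 ?mulr0 ?expR0 ?mulr1// => k _.
by rewrite !expr1n subrr mul0r.
Qed.

Lemma queue_pgf_gt0 z t i : 0 < z -> 0 <= t -> 0 < queue_pgf z t i.
Proof.
by move=> z0 t0; rewrite mulr_gt0 ?expR_gt0// exprn_gt0// bernoulli_pgf_gt0.
Qed.

Lemma is_derive_bernoulli_pgf (z t : R) :
  is_derive t 1 (bernoulli_pgf z) (mu * (1 - bernoulli_pgf z t)).
Proof.
rewrite /bernoulli_pgf; apply: trigger_derive.
rewrite /GRing.scale/=; ring.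
Qed.

Lemma is_derive_batch_exponent (z t : R) m :
  is_derive t 1
    (fun t => \sum_(0 <= k < m) (z ^+ k.+1 - bernoulli_pgf z t ^+ k.+1) / k.+1%:R)
    (mu * (bernoulli_pgf z t ^+ m - 1)).
Proof.
elim: m => [|m IH].
  under [X in is_derive _ _ X _]eq_fun do rewrite big_nil.
  by rewrite expr0 subrr mulr0; exact: is_derive_cst.
under [X in is_derive _ _ X _]eq_fun do rewrite big_nat_recr//=.
have da := is_derive_bernoulli_pgf z t.
have m0 : m.+1%:R != 0 :> R by rewrite pnatr_eq0.
have d2 : is_derive t 1
    (fun t => (z ^+ m.+1 - bernoulli_pgf z t ^+ m.+1) / m.+1%:R)
    (- (mu * (1 - bernoulli_pgf z t) * bernoulli_pgf z t ^+ m)).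
  have dX := is_derive_pow m.+1 da.
  apply: is_derive_eq; rewrite /GRing.scale/=.
  by field.
apply: is_derive_eq; rewrite exprS; ring.
Qed.

(** The factor for the initial customers accounts for the departures, the
    derivative of the exponent for the arriving batches. *)
Lemma queue_pgf_backward_solution z :
  backward_solution lam mu n (queue_pgf z).
Proof.
move=> i t t0.
have d : is_derive t 1 (fun t => queue_pgf z t i)
    (batch_op lam mu n (queue_pgf z t) i).
  rewrite /queue_pgf.
  have da := is_derive_bernoulli_pgf z t.
  have db := is_derive_batch_exponent z t n.
  have dX := is_derive_pow i da.
  apply: is_derive_eq.
  rewrite /batch_op /queue_pgf /GRing.scale/= exprD.
  have mu1 : mu != 0 by rewrite gt_eqF.
  by case: i {dX} => [|i]; rewrite /= ?exprS; field; exact: mu1.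
split=> [|_]; first exact: is_derive_at_right.
by apply: cvg_at_left_filter; exact: is_derive_continuous d.
Qed.

(** The ratio of queue_pgf at z to queue_pgf at z' is at most a constant times
    the i-th power of the ratio of bernoulli_pgf at z to bernoulli_pgf at z', and
    the latter ratio stays below some r < 1 for t in [0, T]. *)
Lemma queue_pgf_dominated z z' e T : 0 < z -> z < z' -> 1 < z' -> 0 < e ->
  exists K, forall t i, 0 <= t <= T -> (K <= i)%N ->
    queue_pgf z t i <= e * queue_pgf z' t i.
Proof.
move=> z0 zz' z'1 e0.
pose B := expR (lam / mu * \sum_(0 <= k < n) z ^+ k.+1 / k.+1%:R).
have B0 : 0 < B by exact: expR_gt0.
have z'0 : 0 < z' by exact: lt_trans zz'.
pose eta := (z' - z) * expR (- (mu * T)).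
have eta0 : 0 < eta by rewrite mulr_gt0 ?expR_gt0// subr_gt0.
pose r := 1 - Num.min eta z' / z'.
have r0 : 0 <= r by rewrite subr_ge0 ler_pdivrMr// mul1r ge_min lexx orbT.
have r1 : r < 1 by rewrite ltrBlDr ltrDl divr_gt0// lt_min eta0.
have : r ^+ k @[k --> \oo] --> 0 by apply: cvg_expr; rewrite ger0_norm.
move=> /cvgr0_norm_le => /(_ _ (divr_gt0 e0 B0)) [K _ KP].
exists K => t i /andP[t0 tT] Ki.
have a0 := bernoulli_pgf_gt0 z0 t0; have a'0 := bernoulli_pgf_gt0 z'0 t0.
have a'z' := bernoulli_pgf_le (ltW z'1) t0.
have rk : r ^+ i * B <= e.
  by have := KP i Ki; rewrite /= ger0_norm ?exprn_ge0// ler_pdivlMr.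
have ar : bernoulli_pgf z t <= r * bernoulli_pgf z' t.
  rewrite /r mulrBl mul1r mulrAC lerBrDr.
  have -> : bernoulli_pgf z' t =
      bernoulli_pgf z t + (z' - z) * expR (- (mu * t)).
    by rewrite /bernoulli_pgf; ring.
  rewrite lerD2l; apply: (@le_trans _ _ (Num.min eta z')).
    rewrite ler_pdivrMr// ler_pM2l; last by rewrite lt_min eta0.
    by apply: le_trans a'z'; rewrite /bernoulli_pgf; lra.
  rewrite ge_min; apply/orP; left; rewrite /eta ler_pM2l ?subr_gt0//.
  by rewrite ler_expR lerN2 ler_pM2l.
have le1 : queue_pgf z t i <= bernoulli_pgf z t ^+ i * B.
  rewrite /queue_pgf ler_pM2l ?exprn_gt0// ler_expR ler_pM2l ?divr_gt0//.
  apply: ler_sum => k _; rewrite ler_pM2r ?invr_gt0 ?ltr0n// gerBl.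
  by rewrite exprn_ge0// ltW.
have le2 : bernoulli_pgf z' t ^+ i <= queue_pgf z' t i.
  rewrite /queue_pgf ler_peMr ?exprn_ge0 ?(ltW a'0)// -expR0 ler_expR.
  apply: mulr_ge0; first by rewrite divr_ge0 ?ltW.
  apply: sumr_ge0 => k _.
  rewrite divr_ge0// subr_ge0 lerXn2r ?nnegrE ?(ltW a'0) ?(ltW z'0)//.
apply: (le_trans le1); apply: (@le_trans _ _ (e * bernoulli_pgf z' t ^+ i)).
  apply: (@le_trans _ _ ((r * bernoulli_pgf z' t) ^+ i * B)).
    rewrite ler_pM2r// lerXn2r// nnegrE; first exact: ltW.
    by rewrite mulr_ge0// ltW.
  by rewrite exprMn mulrAC ler_pM2r ?exprn_gt0.
by rewrite ler_pM2l.
Qed.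

End explicit_solution.

Section queue_generating_function.
Variables (R : realType) (lam mu : R) (n : nat) (p : R -> nat -> nat -> R).
Hypotheses (lam0 : 0 < lam) (mu0 : 0 < mu) (n0 : (0 < n)%N).
Hypotheses (hp : is_transition_function p)
  (hG : has_generator p (batch_generator lam mu n)).

Let partial_pgf z N (t : R) i : R := \sum_(0 <= j < N) p t i j * z ^+ j.

Let partial_pgf_backward_solution z N :
  backward_solution lam mu n (partial_pgf z N).
Proof.
elim: N => [|N IH].
  rewrite (_ : partial_pgf z 0 = fun t i => 0 * p t i 0%N + 0 * p t i 0%N).
    by apply: backward_solution_lin; exact: transition_backward_solution.
  apply/funext => t; apply/funext => i.
  by rewrite /partial_pgf big_nil !mul0r addr0.
rewrite (_ : partial_pgf z N.+1 =
    fun t i => 1 * partial_pgf z N t i + z ^+ N * p t i N).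
  apply: backward_solution_lin => //; exact: transition_backward_solution.
apply/funext => t; apply/funext => i; rewrite /partial_pgf big_nat_recr//=.
by rewrite mul1r (mulrC (p _ _ _)).
Qed.

Let partial_pgf0 z N i : partial_pgf z N 0 i = if (i < N)%N then z ^+ i else 0.
Proof.
have [_ _ p0 _] := hp; rewrite /partial_pgf; under eq_bigr do rewrite p0.
case: ltnP => iN.
  rewrite (bigD1_seq i) ?mem_index_iota ?iota_uniq//= eqxx mul1r.
  by rewrite big1 ?addr0// => k /negPf; rewrite eq_sym => ->; rewrite mul0r.
rewrite big1_seq// => k /andP[_]; rewrite mem_index_iota => /andP[_ kN].
by rewrite gtn_eqF ?mul0r// (leq_trans kN).
Qed.

Let partial_pgf_ge0 z N t i : 0 < z -> 0 <= t -> 0 <= partial_pgf z N t i.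
Proof.
move=> z0 t0; apply: sumr_ge0 => k _.
by rewrite mulr_ge0 ?exprn_ge0 ?(ltW z0)// transition_ge0.
Qed.

(** The partial sums of the generating function are bounded solutions of the
    backward equation, so each of the two inequalities below is an application
    of the minimum principle. The explicit solution for some z' > max(z, 1), with
    an arbitrarily small coefficient, makes the difference nonnegative at large
    states; this is also what makes the series converge when z > 1. *)
Let partial_pgf_le z N t i : 0 < z -> 0 <= t ->
  partial_pgf z N t i <= queue_pgf lam mu n z t i.
Proof.
move=> z0 t0; pose z' := z + 1; have z'1 : 1 < z' by rewrite ltrDr.
have z'0 : 0 < z' by exact: lt_trans z'1.
apply/ler_addgt0Pr => e e0; pose e' := e / queue_pgf lam mu n z' t i.
have g'0 : 0 < queue_pgf lam mu n z' t i by exact: queue_pgf_gt0.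
have e'0 : 0 < e' by rewrite divr_gt0.
pose C := 1 + \sum_(0 <= j < N) z ^+ j.
have C0 : 0 < C.
  by rewrite ltr_wpDr// sumr_ge0// => k _; rewrite exprn_ge0// ltW.
(* The constant C is compared with e' * queue_pgf z' through queue_pgf 1 = 1. *)
have [K KP] := queue_pgf_dominated n lam0 mu0 t ltr01 z'1 z'1 (divr_gt0 e'0 C0).
pose w s j : R := 1 * (1 * queue_pgf lam mu n z s j +
  e' * queue_pgf lam mu n z' s j) + (-1) * partial_pgf z N s j.
suff : 0 <= w t i by rewrite /w /e' mulfVK ?gt_eqF//; lra.
apply: (@minimum_principle _ lam mu n lam0 mu0 w t K); last by rewrite t0 lexx.
- apply: backward_solution_lin; last exact: partial_pgf_backward_solution.
  by apply: backward_solution_lin; exact: queue_pgf_backward_solution.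
- move=> j; rewrite /w partial_pgf0 !queue_pgf0//.
  have zj : 0 < z ^+ j by rewrite exprn_gt0.
  have z'j : 0 < e' * z' ^+ j by rewrite mulr_gt0// exprn_gt0.
  by rewrite !mul1r mulN1r; case: ifP => _; rewrite ?subrr ?subr0; lra.
move=> s j st Kj; have /andP[s0 _] := st.
have g0 : 0 < queue_pgf lam mu n z s j by exact: queue_pgf_gt0.
have WC : partial_pgf z N s j <= C.
  apply: (@le_trans _ _ (\sum_(0 <= j < N) z ^+ j)); last by rewrite lerDr.
  apply: ler_sum => k _; rewrite ler_piMl ?exprn_ge0 ?(ltW z0)//.
  exact: transition_le1.
have := KP s j st Kj; rewrite queue_pgf1 mulrAC ler_pdivlMr// mul1r => Ce.
rewrite /w !mul1r mulN1r subr_ge0 (le_trans WC)// (le_trans Ce)//.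
by rewrite lerDr ltW.
Qed.

Let partial_pgf_ge z e t i : 0 < z -> 0 < e -> 0 <= t ->
  exists N, forall M, (N <= M)%N ->
    queue_pgf lam mu n z t i - e <= partial_pgf z M t i.
Proof.
move=> z0 e0 t0; pose z' := z + 1; have z'1 : 1 < z' by rewrite ltrDr.
have zz' : z < z' by rewrite ltrDl.
have z'0 : 0 < z' by exact: lt_trans z'1.
pose e' := e / queue_pgf lam mu n z' t i.
have g'0 : 0 < queue_pgf lam mu n z' t i by exact: queue_pgf_gt0.
have e'0 : 0 < e' by rewrite divr_gt0.
(* Beyond K the term e' * z' ^+ j exceeds z ^+ j at time 0, which covers the
   states j >= M that the truncated sum misses. *)
have [K KP] := queue_pgf_dominated n lam0 mu0 t z0 zz' z'1 e'0.
exists K => M KM.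
pose w s j : R := 1 * (1 * partial_pgf z M s j + e' * queue_pgf lam mu n z' s j)
  + (-1) * queue_pgf lam mu n z s j.
suff : 0 <= w t i by rewrite /w /e' mulfVK ?gt_eqF//; lra.
apply: (@minimum_principle _ lam mu n lam0 mu0 w t K); last by rewrite t0 lexx.
- apply: backward_solution_lin; last exact: queue_pgf_backward_solution.
  apply: backward_solution_lin; first exact: partial_pgf_backward_solution.
  exact: queue_pgf_backward_solution.
- move=> j; rewrite /w partial_pgf0 !queue_pgf0//.
  have zj : 0 < z ^+ j by rewrite exprn_gt0.
  have z'j : 0 < e' * z' ^+ j by rewrite mulr_gt0// exprn_gt0.
  rewrite !mul1r mulN1r; case: ltnP => jM; first by lra.
  have := KP 0 j; rewrite lexx t0 => /(_ isT (leq_trans KM jM)).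
  by rewrite !queue_pgf0; lra.
move=> s j st Kj; have /andP[s0 _] := st.
rewrite /w !mul1r mulN1r subr_ge0 (le_trans (KP s j st Kj))// lerDr.
exact: partial_pgf_ge0.
Qed.

Lemma transition_pgf z t i : 0 < z -> 0 <= t ->
  series (fun j => p t i j * z ^+ j) @ \oo --> queue_pgf lam mu n z t i.
Proof.
move=> z0 t0; apply/cvgrPdist_le => e e0.
have [N NP] := partial_pgf_ge i z0 e0 t0; exists N => // M /= NM.
rewrite /series/= -/(partial_pgf z M t i) ger0_norm ?subr_ge0 ?partial_pgf_le//.
by rewrite lerBlDr -lerBlDl NP.
Qed.

End queue_generating_function.

Section moment_generating_function.
Variables (R : realType) (d : measure_display) (T : measurableType d).
Variable P : probability T R.

Lemma expectation_nat_valued (X : {RV P >-> nat}) (f : nat -> R) (q : nat -> R)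
    (l : R) :
  (forall j, 0 <= f j) -> (forall j, P [set w | X w = j] = (q j)%:E) ->
  series (fun j => q j * f j) @ \oo --> l ->
  ('E_P[fun w => f (X w)] = l%:E)%E.
Proof.
move=> f0 Pq ql; rewrite unlock.
have cover : \bigcup_j (X @^-1` [set j]) = [set: T].
  by apply/seteqP; split => // w _; exists (X w).
have mf : measurable_fun [set: T] (EFin \o (f \o X)).
  by apply/measurable_EFinP; exact: measurableT_comp.
rewrite -cover ge0_integral_bigcup//=; first last.
- by move=> i j _ _ [w [<- <-]].
- by move=> w _; rewrite lee_fin.
- by rewrite cover.
- by move=> k; exact: measurable_funPTI.
have -> : (\sum_(j <oo) \int[P]_(w in X @^-1` [set j]) (f (X w))%:E)%E =
    limn (EFin \o series (fun j => q j * f j)).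
  congr (limn _); apply/funext => N; rewrite /= /series/= -sumEFin.
  apply: eq_bigr => j _.
  rewrite (eq_integral (fun=> (f j)%:E)); last by move=> w; rewrite inE => /= ->.
  rewrite integral_cst; last exact: measurable_funPTI.
  by rewrite EFinM muleC; congr (_ * _)%E; exact: Pq.
by rewrite EFin_lim ?(cvg_lim _ ql)//; apply/cvg_ex; exists l.
Qed.

(** The Markov property with an empty history, conditioned on the almost sure
    event that the queue starts from q0. *)
Lemma queue_marginal (lam mu : R) n q0 (X : R -> {RV P >-> nat}) :
  batch_infinite_server_queue lam mu n q0 X ->
  exists p, [/\ is_transition_function p,
    has_generator p (batch_generator lam mu n) &
    forall t j, 0 <= t -> P [set w | X t w = j] = (p t q0 j)%:E].
Proof.
move=> [[p [hp hG hM]] PX0]; exists p; split=> // t j t0.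
have mX s k : measurable [set w | X s w = k].
  exact: (measurable_funPTI (X s) (Y := [set k])).
have := hM 0 t q0 j [::] (lexx 0) t0; rewrite add0r /=.
rewrite (_ : [set w | X 0 w = q0 /\ _] = [set w | X 0 w = q0]); last first.
  by apply/seteqP; split => w /=; [case|split].
rewrite PX0 mul1e => <-; last by [].
apply: (etrans (measureDI P (mX t j) (mX 0 q0))).
rewrite setIC -[RHS]add0e; congr (_ + _)%E.
apply: (subset_measure0 (B := ~` [set w | X 0 w = q0])) => //.
- exact: measurableD.
- exact: measurableC.
by apply: (etrans (probability_setC P (mX 0 q0))); rewrite PX0 subee.
Qed.

(** As e^(theta j / n) is the j-th power of e^(theta / n), the expectation is the
    series of transition_pgf. *)
Lemma queue_mgf (lam mu : R) n q0 (X : R -> {RV P >-> nat}) theta t :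
  0 < lam -> 0 < mu -> (0 < n)%N -> batch_infinite_server_queue lam mu n q0 X ->
  0 <= t ->
  mmt_gen_fun P (fun w => (X t w)%:R / n%:R) theta =
  (queue_pgf lam mu n (expR (theta / n%:R)) t q0)%:E.
Proof.
move=> lam0 mu0 n0 /queue_marginal[p [hp hG Pp]] t0; rewrite /mmt_gen_fun.
rewrite (_ : expR \o _ = fun w => expR (theta / n%:R) ^+ (X t w)); last first.
  apply/funext => w /=; rewrite -expRM_natl; congr expR.
  by rewrite mulrC mulrCA mulrA.
apply: (expectation_nat_valued (q := p t q0)) => [j|j|].
- by rewrite exprn_ge0// expR_ge0.
- exact: Pp.
by apply: transition_pgf => //; exact: expR_gt0.
Qed.

End moment_generating_function.

(** * The entire exponential integral *)

Section entire_exponential_integral.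
Variable R : realType.
Implicit Types x c : R.

Let coef (k : nat) : R := (k%:R * k`!%:R)^-1.

(** The power series with coefficients 1 / (k k!) for k > 0; the term k = 0
    vanishes since the inverse of 0 is 0. This is the integral over [0, x] of
    (e^u - 1) / u. *)
Definition Ein x : R := limn (pseries coef x).

Let cvg_pseries_le_fact (a : nat -> R) x :
  (forall k, 0 <= a k <= k`!%:R^-1) -> cvgn (pseries a x).
Proof.
move=> ha; apply: normed_cvg; apply: series_le_cvg (is_cvg_series_exp_coeff `|x|).
- by move=> k /=; exact: normr_ge0.
- by move=> k; apply: exp_coeff_ge0.
move=> k; have /andP[a0 a1] := ha k.
by rewrite /exp_coeff /= normrM normrX ger0_norm// mulrC ler_wpM2l// exprn_ge0.
Qed.

Let coefP k : 0 <= coef k <= k`!%:R^-1.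
Proof.
rewrite invr_ge0 mulr_ge0//=; case: k => [|k]; first by rewrite /coef mul0r invr0.
rewrite lef_pV2 ?posrE ?mulr_gt0 ?ltr0n ?fact_gt0//.
by rewrite ler_peMl// ler1n.
Qed.

Let dcoefE k : pseries_diffs coef k = (k.+1)`!%:R^-1.
Proof.
by rewrite /pseries_diffs /coef invfM mulrA mulfV ?mul1r// pnatr_eq0.
Qed.

Let dcoefP k : 0 <= pseries_diffs coef k <= k`!%:R^-1.
Proof.
rewrite dcoefE invr_ge0 ler0n/= lef_pV2 ?posrE ?ltr0n ?fact_gt0//.
by rewrite ler_nat factS leq_pmull.
Qed.

Let ddcoefP k : 0 <= pseries_diffs (pseries_diffs coef) k <= k`!%:R^-1.
Proof.
rewrite {1 3}/pseries_diffs dcoefE mulr_ge0//= factS natrM invfM mulrA.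
apply: (@le_trans _ _ ((k.+1)`!%:R^-1)).
  rewrite ler_piMl ?invr_ge0// ler_pdivrMr ?ltr0n// mul1r ler_nat.
  exact: leqnSn.
by rewrite lef_pV2 ?posrE ?ltr0n ?fact_gt0// ler_nat factS leq_pmull.
Qed.

Let is_derive_Ein_series x :
  is_derive x 1 Ein (limn (pseries (pseries_diffs coef) x)).
Proof.
apply: (@pseries_snd_diffs _ _ (`|x| + 1)).
- exact: cvg_pseries_le_fact.
- exact: cvg_pseries_le_fact.
- exact: cvg_pseries_le_fact.
by rewrite [ltRHS]ger0_norm ?addr_ge0// ltrDl.
Qed.

Let mul_dEin x : x * limn (pseries (pseries_diffs coef) x) = expR x - 1.
Proof.
have cv : cvgn (pseries (pseries_diffs coef) x) by exact: cvg_pseries_le_fact.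
have h1 : x * pseries (pseries_diffs coef) x N @[N --> \oo] -->
    x * limn (pseries (pseries_diffs coef) x) by apply: cvgMr.
have h2 : series (exp_coeff x) N.+1 - 1 @[N --> \oo] --> expR x - 1.
  apply: cvgB; last exact: cvg_cst.
  rewrite (cvg_shiftS (series (exp_coeff x))).
  exact: is_cvg_series_exp_coeff.
apply: (cvg_unique _ h1) => //; apply: cvg_trans h2; apply: near_eq_cvg.
near=> N; rewrite /series/= big_nat_recl//= /exp_coeff/= expr0 fact0 divr1.
rewrite addrAC subrr add0r mulr_sumr; apply: eq_bigr => k _.
by rewrite /mk_sequence dcoefE exprS; ring.
Unshelve. all: by end_near. Qed.

Lemma is_derive_Ein x : x != 0 -> is_derive x 1 Ein ((expR x - 1) / x).
Proof.
move=> x0; rewrite -mul_dEin mulrAC mulfV// mul1r; exact: is_derive_Ein_series.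
Qed.

Lemma continuous_Ein : continuous Ein.
Proof. by move=> x; apply: is_derive_continuous; exact: is_derive_Ein_series. Qed.

Lemma Ein0 : Ein 0 = 0.
Proof.
apply/cvg_lim => //; apply: cvg_near_cst; near=> N.
apply: big1_seq => -[|k] _ /=.
  by rewrite /mk_sequence /coef mul0r invr0 mul0r.
by rewrite exprS mul0r mulr0.
Unshelve. all: by end_near. Qed.

(** The discrete counterpart of Ein, obtained by replacing e^u with
    (1 + u / n)^n under the integral sign. Its value at - n is minus the n-th
    harmonic number. *)
Definition Ein_n (n : nat) x : R :=
  \sum_(0 <= k < n) ((1 + x / n%:R) ^+ k.+1 - 1) / k.+1%:R.

Lemma Ein_n0 n : Ein_n n 0 = 0.
Proof.
by rewrite /Ein_n big1// => k _; rewrite mul0r addr0 expr1n subrr mul0r.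
Qed.

Lemma Ein_nN n : (0 < n)%N -> Ein_n n (- n%:R) = - series harmonic n.
Proof.
move=> n0; rewrite /Ein_n /series/= -sumrN; apply: eq_bigr => k _.
by rewrite mulNr mulfV ?pnatr_eq0 -?lt0n// subrr expr0n/= sub0r mulN1r.
Qed.

Let is_derive_base (n : nat) (x : R) :
  is_derive x 1 (fun x => 1 + x / n%:R) n%:R^-1.
Proof. by apply: is_derive_eq; rewrite /GRing.scale/=; ring. Qed.

Lemma is_derive_Ein_n (n : nat) (x : R) : (0 < n)%N -> x != 0 ->
  is_derive x 1 (Ein_n n) (((1 + x / n%:R) ^+ n - 1) / x).
Proof.
move=> n0 x0; have nR : n%:R != 0 :> R by rewrite pnatr_eq0 -lt0n.
rewrite /Ein_n; move: {1 4}n => m; elim: m => [|m IH].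
  under [X in is_derive _ _ X _]eq_fun do rewrite big_nil.
  by rewrite expr0 subrr mul0r; exact: is_derive_cst.
under [X in is_derive _ _ X _]eq_fun do rewrite big_nat_recr//=.
have m0 : m.+1%:R != 0 :> R by rewrite pnatr_eq0.
have d2 : is_derive x 1 (fun x => ((1 + x / n%:R) ^+ m.+1 - 1) / m.+1%:R)
    ((1 + x / n%:R) ^+ m / n%:R).
  have dX := is_derive_pow m.+1 (is_derive_base n x).
  apply: is_derive_eq; rewrite /GRing.scale/=; field.
  by rewrite nR nat1r.
by apply: is_derive_eq; rewrite exprS; field; rewrite ?nR ?x0.
Qed.

Lemma continuous_Ein_n n : continuous (Ein_n n).
Proof.
move=> x; rewrite /Ein_n; apply: cvg_big; first exact: add_continuous.
move=> k _; apply: cvgM; last exact: cvg_cst.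
apply: cvgB; last exact: cvg_cst.
exact: (is_derive_continuous (is_derive_pow k.+1 (is_derive_base n x))).
Qed.

End entire_exponential_integral.

(** * Discrete approximation and the Euler-Mascheroni constant *)

Section approximation.
Variable R : realType.
Implicit Types x c h : R.

Lemma cvg_natrV : n%:R^-1 @[n --> \oo] --> (0 : R).
Proof. by rewrite -cvg_shiftS; exact: cvg_harmonic. Qed.

Lemma derivable_in_ge0_le (f df : R -> R) (a b : R) : a <= b ->
  (forall x, x \in `]a, b[ -> is_derive x 1 f (df x)) ->
  {within `[a, b], continuous f} ->
  (forall x, x \in `]a, b[ -> 0 <= df x) -> f a <= f b.
Proof.
rewrite le_eqVlt => /predU1P[->//|ab] hf cf df0.
have [c cab E] := MVT ab hf cf.
by rewrite -subr_ge0 E mulr_ge0 ?df0// subr_ge0 ltW.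
Qed.

(** Follows from e^h - 1 <= h e^h, which is 1 - h <= e^(-h). *)
Lemma expR_sub1D_le h : `|expR h - (1 + h)| <= h ^+ 2 * expR `|h|.
Proof.
rewrite ger0_norm ?subr_ge0 ?expR_ge1Dx//.
have up (y : R) : expR y - 1 <= y * expR y.
  have := expR_ge1Dx (- y); rewrite expRN => e1.
  have := ler_wpM2r (expR_ge0 y) e1; rewrite mulVf ?gt_eqF ?expR_gt0//; lra.
have e1 := expR_ge1Dx h; have e2 := up h.
have e3 : expR h - (1 + h) <= h * (expR h - 1) by lra.
apply: (le_trans e3); rewrite expr2 -mulrA.
have [h0|h0] := leP 0 h; first by rewrite ler_wpM2l// ger0_norm.
rewrite ler_wnM2l ?(ltW h0)//; apply: (@le_trans _ _ h); last by lra.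
rewrite ler_neMr ?(ltW h0)// leNgt expR_lt1 -leNgt.
exact: normr_ge0.
Qed.

Lemma subrX_norm_le (x y B : R) n : 1 <= B -> `|x| <= B -> `|y| <= B ->
  `|x ^+ n - y ^+ n| <= n%:R * `|x - y| * B ^+ n.
Proof.
move=> B1 xB yB; elim: n => [|n IH]; first by rewrite subrr normr0 !mul0r.
have -> : x ^+ n.+1 - y ^+ n.+1 = x * (x ^+ n - y ^+ n) + (x - y) * y ^+ n.
  by rewrite !exprS; ring.
have B0 : 0 <= B by lra.
apply: (le_trans (ler_normD _ _)); rewrite !normrM -natr1 exprS.
have h1 : `|x| * `|x ^+ n - y ^+ n| <= B * (n%:R * `|x - y| * B ^+ n).
  exact: ler_pM.
have h2 : `|x - y| * `|y ^+ n| <= `|x - y| * (B * B ^+ n).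
  rewrite ler_wpM2l// normrX (@le_trans _ _ (B ^+ n))//.
    by rewrite lerXn2r// nnegrE.
  by rewrite ler_peMl// exprn_ge0.
have -> : (n%:R + 1) * `|x - y| * (B * B ^+ n) =
  B * (n%:R * `|x - y| * B ^+ n) + `|x - y| * (B * B ^+ n) by ring.
exact: lerD.
Qed.

Lemma expR_sub_powD_le x n : (0 < n)%N ->
  `|expR x - (1 + x / n%:R) ^+ n| <= x ^+ 2 * expR (2 * `|x|) / n%:R.
Proof.
move=> n0; have nR : 0 < n%:R :> R by rewrite ltr0n.
have n1 : 1 <= n%:R :> R by rewrite ler1n.
pose h := x / n%:R; pose B := expR `|h|.
have B1 : 1 <= B by rewrite leNgt expR_lt1 -leNgt normr_ge0.
have E : expR x = expR h ^+ n by rewrite -expRM_natl /h mulrCA mulfV ?mulr1// gt_eqF.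
have Bn : B ^+ n = expR `|x|.
  by rewrite -expRM_natl /h normrM normfV (gtr0_norm nR) mulrCA mulfV ?mulr1// gt_eqF.
rewrite E -/h; have := @subrX_norm_le (expR h) (1 + h) B n B1.
rewrite ger0_norm ?expR_ge0// ler_expR ler_norm => /(_ isT).
have -> : `|1 + h| <= B.
  rewrite (le_trans (ler_normD _ _))// normr1; exact: expR_ge1Dx.
move=> /(_ isT) => /le_trans; apply.
have hx : h ^+ 2 = x ^+ 2 / n%:R ^+ 2 by rewrite /h expr_div_n.
have Bx : B <= expR `|x|.
  rewrite ler_expR /h normrM normfV (gtr0_norm nR) ler_pdivrMr//.
  by rewrite ler_peMr.
have -> : x ^+ 2 * expR (2 * `|x|) / n%:R =
  n%:R * (h ^+ 2 * expR `|x|) * expR `|x|.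
  rewrite hx mulrDl mul1r expRD; field; exact: lt0r_neq0.
rewrite Bn ler_wpM2r ?expR_ge0// ler_wpM2l// (le_trans (expR_sub1D_le h))//.
by rewrite ler_wpM2l// sqr_ge0.
Qed.

(** The mean value theorem between 0 and c, where both functions vanish at 0;
    dividing the bound on the difference of the exponentials by x costs only one
    of the two factors x. *)
Lemma Ein_n_sub_le c n : (0 < n)%N ->
  `|Ein_n n c - Ein c| <= c ^+ 2 * expR (2 * `|c|) / n%:R.
Proof.
move=> n0; have nR : 0 < n%:R :> R by rewrite ltr0n.
pose f x := Ein_n n x - Ein x; rewrite -/(f c).
pose df x := ((1 + x / n%:R) ^+ n - 1) / x - (expR x - 1) / x.
have fc : continuous f.
  by move=> x; apply: cvgB; [exact: continuous_Ein_n|exact: continuous_Ein].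
have fd x : x != 0 -> is_derive x 1 f (df x).
  by move=> x0; apply: is_deriveB; [exact: is_derive_Ein_n|exact: is_derive_Ein].
have f0 : f 0 = 0 by rewrite /f Ein0 Ein_n0 subr0.
have dfle x : x != 0 -> `|x| <= `|c| ->
    `|df x| <= `|c| * expR (2 * `|c|) / n%:R.
  move=> x0 xc; have xp : 0 < `|x| by rewrite normr_gt0.
  have -> : df x = - ((expR x - (1 + x / n%:R) ^+ n) / x).
    by rewrite /df; field.
  rewrite normrN normrM normfV ler_pdivrMr//.
  apply: (le_trans (expR_sub_powD_le x n0)).
  rewrite [leRHS]mulrAC ler_pM2r ?invr_gt0// -[x ^+ 2]real_normK ?num_real//.
  rewrite [leRHS]mulrC expr2 -mulrA ler_wpM2l//.
  by apply: ler_pM; rewrite ?expR_ge0// ler_expR ler_pM2l.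
have E : c ^+ 2 * expR (2 * `|c|) / n%:R =
    `|c| * expR (2 * `|c|) / n%:R * `|c|.
  by rewrite -[c ^+ 2]real_normK ?num_real//; ring.
rewrite E; have [cneg|cpos|->] := ltgtP c 0; last by rewrite f0 !normr0 mulr0.
- have fd' x : x \in `]c, 0[ -> is_derive x 1 f (df x).
    by rewrite in_itv/= => /andP[_ x0]; apply: fd; rewrite lt_eqF.
  have [x] := MVT cneg fd' (continuous_subspaceT fc).
  rewrite in_itv/= f0 !sub0r => /andP[cx x0] /(congr1 Num.norm).
  rewrite normrN normrM normrN => ->; rewrite ler_wpM2r// dfle ?lt_eqF//.
  by rewrite !ltr0_norm// lerN2 ltW.
- have fd' x : x \in `]0, c[ -> is_derive x 1 f (df x).
    by rewrite in_itv/= => /andP[x0 _]; apply: fd; rewrite gt_eqF.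
  have [x] := MVT cpos fd' (continuous_subspaceT fc).
  rewrite in_itv/= f0 !subr0 => /andP[x0 xc] ->.
  rewrite normrM ler_wpM2r// dfle ?gt_eqF//.
  by rewrite !gtr0_norm// ltW.
Qed.

(** The estimate of Ein_n_sub_le is uniform on bounded sets, which lets the
    argument vary with n. *)
Lemma cvg_Ein_n (u : nat -> R) c : u n @[n --> \oo] --> c ->
  Ein_n n (u n) @[n --> \oo] --> Ein c.
Proof.
move=> uc; have : Ein (u n) @[n --> \oo] --> Ein c.
  exact: (continuous_cvg _ (@continuous_Ein R c) uc).
apply: cvg_sub0; pose b n := u n ^+ 2 * expR (2 * `|u n|) * n%:R^-1.
have b0 : b n @[n --> \oo] --> 0.
  rewrite -(mulr0 (c ^+ 2 * expR (2 * `|c|))); apply: cvgM; last exact: cvg_natrV.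
  apply: cvgM; first exact: (cvgM uc uc).
  apply: (continuous_cvg _ (@continuous_expR R _)).
  by apply: cvgMr; exact: cvg_norm.
have nb0 : - b n @[n --> \oo] --> 0 by rewrite -oppr0; exact: cvgN.
apply: (squeeze_cvgr _ nb0 b0); near=> n.
have n0 : (0 < n)%N by near: n; exists 1%N.
by have := Ein_n_sub_le (u n) n0; rewrite ler_norml.
Unshelve. all: by end_near. Qed.

Lemma bernoulli_inequality (y : R) m : 0 <= y <= 1 -> 1 - m%:R * y <= (1 - y) ^+ m.
Proof.
move=> /andP[y0 y1]; elim: m => [|m IH]; first by rewrite mul0r subr0.
rewrite exprS; apply: (@le_trans _ _ ((1 - y) * (1 - m%:R * y))); last first.
  by rewrite ler_wpM2l// subr_ge0.
have : 0 <= m%:R * (y * y) by rewrite !mulr_ge0.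
by rewrite -natr1; lra.
Qed.

(** For x between 0 and n the error of (1 - x / n)^n is at most x^2 e^(-x) / n,
    because (1 - h) e^h >= 1 - h^2 and by Bernoulli's inequality; the
    exponential factor is what makes the estimate of Ein at - n, where n grows,
    possible. *)
Lemma pow1B_bounds x n : (0 < n)%N -> 0 <= x <= n%:R ->
  expR (- x) * (1 - x ^+ 2 / n%:R) <= (1 - x / n%:R) ^+ n <= expR (- x).
Proof.
move=> n0 /andP[x0 xn]; have nR : 0 < n%:R :> R by rewrite ltr0n.
pose h := x / n%:R; rewrite -/h.
have h0 : 0 <= h by rewrite divr_ge0// ltW.
have h1 : h <= 1 by rewrite ler_pdivrMr// mul1r.
have E : expR (- x) = expR (- h) ^+ n.
  by rewrite -expRM_natl /h mulrN mulrCA mulfV ?mulr1// gt_eqF.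
have h2 : 0 <= h ^+ 2 <= 1 by rewrite sqr_ge0 expr_le1.
rewrite E; apply/andP; split; last first.
  by rewrite lerXn2r ?nnegrE ?expR_ge0 ?subr_ge0//; have := expR_ge1Dx (- h); lra.
have -> : 1 - x ^+ 2 / n%:R = 1 - n%:R * h ^+ 2.
  by rewrite /h expr_div_n; field; rewrite gt_eqF.
apply: (@le_trans _ _ ((expR (- h) * (1 - h ^+ 2)) ^+ n)).
  rewrite (exprMn _ (expR (- h))) ler_wpM2l ?exprn_ge0 ?expR_ge0//.
  exact: bernoulli_inequality.
have /andP[_ h21] := h2.
rewrite lerXn2r ?nnegrE ?mulr_ge0 ?expR_ge0 ?subr_ge0//.
have e1 : expR (- h) * (1 + h) <= 1.
  by rewrite expRN mulrC ler_pdivrMr ?expR_gt0// mul1r expR_ge1Dx.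
have -> : expR (- h) * (1 - h ^+ 2) = (1 - h) * (expR (- h) * (1 + h)) by ring.
by rewrite ler_piMr// subr_ge0.
Qed.

(** The derivative of x |-> Ein (- x) - Ein_n n (- x) lies between 0 and
    x e^(-x) / n, and the latter has the bounded antiderivative
    - (x + 1) e^(-x) / n. *)
Lemma Ein_sub_Ein_nN n : (0 < n)%N ->
  0 <= Ein (- n%:R : R) - Ein_n n (- n%:R) <= n%:R^-1.
Proof.
move=> n0; have nR : 0 < n%:R :> R by rewrite ltr0n.
pose f x := Ein (- x) - Ein_n n (- x).
pose df x := (expR (- x) - (1 - x / n%:R) ^+ n) / x.
have cf : continuous f.
  move=> x; have cN : -%R y @[y --> x] --> - x by apply: cvgN; exact: cvg_id.
  apply: cvgB.
    exact: (continuous_cvg _ (@continuous_Ein R (- x)) cN).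
  exact: (continuous_cvg _ (@continuous_Ein_n R n (- x)) cN).
have fd (x : R) : x \in `]0, n%:R[ -> is_derive x 1 f (df x).
  rewrite in_itv/= => /andP[x0 _]; have xN : - x != 0 by rewrite oppr_eq0 gt_eqF.
  have d1 := is_derive_Ein xN; have d2 := is_derive_Ein_n n0 xN.
  have dN : is_derive x 1 (fun y : R => - y) (-1) by apply: is_derive_eq.
  have -> : df x = (expR (- x) - 1) / (- x) * (-1) -
      ((1 + - x / n%:R) ^+ n - 1) / (- x) * (-1).
    by rewrite /df mulNr; field; rewrite gt_eqF.
  exact: (is_deriveB (is_derive1_comp d1 dN) (is_derive1_comp d2 dN)).
have f0 : f 0 = 0 by rewrite /f oppr0 Ein0 Ein_n0 subr0.
have bnd x : x \in `]0, n%:R[ -> 0 <= df x <= x * expR (- x) / n%:R.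
  rewrite in_itv/= => /andP[x0 xn].
  have /(pow1B_bounds n0)/andP[lo hi] : 0 <= x <= n%:R by rewrite !ltW.
  rewrite divr_ge0 ?subr_ge0 ?(ltW x0)//= ler_pdivrMr// lerBlDr -lerBlDl.
  by apply: le_trans lo; rewrite le_eqVlt; apply/orP; left; apply/eqP; ring.
rewrite -/(f n%:R); apply/andP; split.
  rewrite -f0.
  apply: (derivable_in_ge0_le (ltW nR) fd (continuous_subspaceT cf)) => x.
  by move=> /bnd/andP[].
pose g x := - (f x + (x + 1) * expR (- x) / n%:R).
pose dg x := x * expR (- x) / n%:R - df x.
have dE x : is_derive x 1 (fun x => (x + 1) * expR (- x) / n%:R)
    (- (x * expR (- x) / n%:R)).
  by apply: is_derive_eq; rewrite /GRing.scale/=; ring.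
have gd (x : R) : x \in `]0, n%:R[ -> is_derive x 1 g (dg x).
  move=> xn; have -> : dg x = - (df x + - (x * expR (- x) / n%:R)).
    by rewrite /dg; ring.
  exact: (is_deriveN (is_deriveD (fd x xn) (dE x))).
have gc : continuous g.
  move=> x; apply: cvgN; apply: cvgD; first exact: cf.
  exact: is_derive_continuous (dE x).
have dg0 x : x \in `]0, n%:R[ -> 0 <= dg x.
  by move=> /bnd/andP[_]; rewrite /dg subr_ge0.
have := derivable_in_ge0_le (ltW nR) gd (continuous_subspaceT gc) dg0.
rewrite /g f0 oppr0 expR0 !add0r !mul1r lerN2; apply: le_trans.
by rewrite lerDl divr_ge0// mulr_ge0 ?expR_ge0// addr_ge0.
Qed.

Let lnEin (x : R) : R := ln x + Ein (- x).

Lemma is_derive_lnEin (x : R) : 0 < x ->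
  is_derive x 1 lnEin (expR (- x) / x).
Proof.
move=> x0; have xN : - x != 0 by rewrite oppr_eq0 gt_eqF.
have dN : is_derive x 1 (fun y : R => - y) (-1) by apply: is_derive_eq.
have -> : expR (- x) / x = x^-1 + (expR (- x) - 1) / (- x) * (-1).
  by field; rewrite gt_eqF.
exact: (is_deriveD (is_derive1_ln x0) (is_derive1_comp (is_derive_Ein xN) dN)).
Qed.

Let lnEin_nd (x y : R) : 1 <= x -> x <= y -> lnEin x <= lnEin y.
Proof.
move=> x1 xy; have pos (z : R) : z \in `[x, y] -> 0 < z.
  by rewrite in_itv/= => /andP[xz _]; lra.
apply: (derivable_in_ge0_le (df := fun z => expR (- z) / z) xy).
- by move=> z /subset_itv_oo_cc/pos; exact: is_derive_lnEin.
- apply: derivable_within_continuous => z /pos z0.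
  exact: (@ex_derive _ _ _ _ _ _ _ (is_derive_lnEin z0)).
by move=> z /subset_itv_oo_cc/pos z0; rewrite divr_ge0 ?expR_ge0// ltW.
Qed.

(** On [1, +oo[ the derivative e^(-x) / x is at most e^(-x), so that adding
    e^(-x) makes the function nonincreasing. *)
Let lnEin_bounded (x : R) : 1 <= x -> lnEin x <= lnEin 1 + expR (- 1).
Proof.
move=> x1; have pos (z : R) : z \in `[1, x] -> 0 < z.
  by rewrite in_itv/= => /andP[xz _]; lra.
pose K (z : R) := - (lnEin z + expR (- z)).
pose dK (z : R) := - (expR (- z) / z + - expR (- z)).
have Kd (z : R) : 0 < z -> is_derive z 1 K (dK z).
  move=> z0; have dN : is_derive z 1 (fun z : R => expR (- z)) (- expR (- z)).
    by apply: is_derive_eq; rewrite /GRing.scale/=; ring.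
  exact: (is_deriveN (is_deriveD (is_derive_lnEin z0) dN)).
suff : K 1 <= K x by rewrite /K; have := expR_ge0 (- x); lra.
apply: (derivable_in_ge0_le (df := dK) x1).
- by move=> z /subset_itv_oo_cc/pos; exact: Kd.
- apply: derivable_within_continuous => z /pos z0.
  exact: (@ex_derive _ _ _ _ _ _ _ (Kd z z0)).
move=> z; rewrite in_itv/= => /andP[z1 _]; rewrite /dK oppr_ge0 subr_le0.
by rewrite ler_pdivrMr ?ler_peMr ?expR_ge0//; lra.
Qed.

Let cvg_lnEin : cvg (lnEin x @[x --> +oo]).
Proof.
(* Cutting off at 1 makes the function monotone on the whole line. *)
pose F (x : R) := lnEin (Num.max x 1).
have ndF : nondecreasing_fun F.
  move=> x y xy; apply: lnEin_nd; first by rewrite le_max lexx orbT.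
  by rewrite le_max2.
have ubF : has_ubound (range F).
  exists (lnEin 1 + expR (- 1)) => _ [x _ <-].
  by apply: lnEin_bounded; rewrite le_max lexx orbT.
apply/cvg_ex; exists (sup (range F)).
apply: cvg_trans (nondecreasing_cvgr ndF ubF); apply: near_eq_cvg; near=> x.
by rewrite /F max_l//; near: x; exact: nbhs_pinfty_ge.
Unshelve. all: by end_near. Qed.

(** The limit exists by monotonicity and is computed along the integers, where
    Ein (- n) may be replaced by minus the harmonic number. *)
Lemma cvg_ln_Ein : ln x + Ein (- x) @[x --> +oo] --> - euler_mascheroni R.
Proof.
have /cvg_ex[L hL] := cvg_lnEin.
suff -> : euler_mascheroni R = - L by rewrite opprK.
have hn : lnEin n%:R @[n --> \oo] --> L.
  by apply: (cvg_comp _ _ _ hL); exact: cvgr_idn.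
have h0 : Ein (- n%:R : R) - Ein_n n (- n%:R) @[n --> \oo] --> (0 : R).
  apply: (squeeze_cvgr _ (cvg_cst 0) cvg_natrV); near=> n.
  by apply: Ein_sub_Ein_nN; near: n; exists 1%N.
apply: cvg_lim => //; rewrite -[X in _ --> X]sub0r.
apply: cvg_trans (cvgB h0 hn); apply: near_eq_cvg; near=> n.
have n0 : (0 < n)%N by near: n; exists 1%N.
by rewrite /= !fctE Ein_nN// /lnEin; ring.
Unshelve. all: by end_near. Qed.

End approximation.

(** * The exponential integrals in terms of Ein *)

Section exponential_integrals.
Variable R : realType.
Implicit Types x s : R.
Let mu := @lebesgue_measure R.
Let f s := expR (- s) / s.

Let continuous_f s : s != 0 -> {for s, continuous f}.
Proof.
move=> s0; apply: cvgM; last exact: cvgV cvg_id.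
apply: (continuous_cvg _ (@continuous_expR R (- s))).
by apply: cvgN; exact: cvg_id.
Qed.

(** ln s + Ein (- s) is an antiderivative of e^(-s) / s and tends to minus the
    Euler-Mascheroni constant at infinity. *)
Lemma E1_Ein x : 0 < x -> E1 x = - euler_mascheroni R - (ln x + Ein (- x)).
Proof.
move=> x0; rewrite /E1.
have pos s : x <= s -> 0 < s by move=> xs; lra.
apply: (Rintegral_ge0_continuous_FTC2y (F := fun s => ln s + Ein (- s))).
- by move=> s /pos s0; rewrite divr_ge0 ?expR_ge0// ltW.
- apply: continuous_in_subspaceT => s; rewrite inE/= in_itv/= andbT => /pos s0.
  by apply: continuous_f; rewrite gt_eqF.
- exact: cvg_ln_Ein.
- move=> s xs.
  exact: (@ex_derive _ _ _ _ _ _ _ (is_derive_lnEin (lt_trans x0 xs))).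
- apply: cvg_at_right_filter; exact: is_derive_continuous (is_derive_lnEin x0).
move=> s; rewrite in_itv/= andbT => xs; rewrite derive1E.
exact: (@derive_val _ _ _ _ _ _ _ (is_derive_lnEin (lt_trans x0 xs))).
Qed.

Let Rintegral_neg x e : 0 < e -> e < x ->
  Rintegral mu `[- x, - e] f = ln e + Ein e - (ln x + Ein x).
Proof.
move=> e0 ex; pose G s := ln (- s) + Ein (- s).
have Gd s : s < 0 -> is_derive s 1 G (f s).
  move=> sn; have Nsp : 0 < - s by rewrite oppr_gt0.
  have dN : is_derive s 1 (fun y : R => - y) (-1) by apply: is_derive_eq.
  have Ns0 : - s != 0 by rewrite gt_eqF.
  have -> : f s = (- s)^-1 * (-1) + (expR (- s) - 1) / (- s) * (-1).
    by rewrite /f; field; rewrite lt_eqF.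
  exact: (is_deriveD (is_derive1_comp (is_derive1_ln Nsp) dN)
                     (is_derive1_comp (is_derive_Ein Ns0) dN)).
have neg s : s \in `[- x, - e] -> s < 0.
  by rewrite in_itv/= => /andP[_ se]; lra.
rewrite /Rintegral (@continuous_FTC2 _ f G).
- by rewrite -EFinB/= /G !opprK.
- by rewrite ltrN2.
- apply: continuous_in_subspaceT => s; rewrite inE/= => /neg s0.
  by apply: continuous_f; rewrite lt_eqF.
- split=> [s /subset_itv_oo_cc/neg s0| |].
  + exact: (@ex_derive _ _ _ _ _ _ _ (Gd s s0)).
  + apply: cvg_at_right_filter; apply: is_derive_continuous (Gd _ _); lra.
  + apply: cvg_at_left_filter; apply: is_derive_continuous (Gd _ _); lra.
move=> s /subset_itv_oo_cc/neg s0; rewrite derive1E.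
exact: (@derive_val _ _ _ _ _ _ _ (Gd s s0)).
Qed.

(** The singular terms ln e and - ln e of the two integrals cancel, and
    Ein e - Ein (- e) tends to 0. *)
Lemma Ei_Ein x : 0 < x -> Ei x = ln x + Ein x + euler_mascheroni R.
Proof.
move=> x0; rewrite /Ei.
have -> : ln x + Ein x + euler_mascheroni R =
  - (- (ln x + Ein x) - euler_mascheroni R + (Ein 0 - Ein (- 0))).
  by rewrite oppr0; ring.
congr (- _); apply: cvg_lim => //.
have cE : Ein e - Ein (- e) @[e --> 0^'+] --> Ein (0 : R) - Ein (- 0).
  apply: cvg_at_right_filter; apply: cvgB; first exact: continuous_Ein.
  by apply: (continuous_cvg _ (@continuous_Ein R _)); apply: cvgN; exact: cvg_id.
apply: cvg_trans (cvgD (cvg_cst _) cE); apply: near_eq_cvg; near=> e.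
have e0 : 0 < e by near: e; exact: nbhs_right_gt.
have ex : e < x by near: e; exact: nbhs_right_lt.
rewrite -/f Rintegral_neg//.
by rewrite -/(E1 e) E1_Ein// !fctE; ring.
Unshelve. all: by end_near. Qed.

End exponential_integrals.

(** * The limits *)

Section limits.
Variables (R : realType) (lam mu theta : R).
Hypotheses (lam0 : 0 < lam) (mu0 : 0 < mu).

Let cvg_expR_scaled : expR (theta / n%:R) @[n --> \oo] --> (1 : R).
Proof.
rewrite -[X in _ --> X]expR0; apply: (continuous_cvg _ (@continuous_expR R 0)).
rewrite -(mulr0 theta); apply: cvgMr; exact: cvg_natrV.
Qed.

Let cvg_scaled_slope :
  n%:R * (expR (theta / n%:R) - 1) @[n --> \oo] --> theta.
Proof.
pose b n := theta ^+ 2 * expR `|theta| * n%:R^-1.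
have b0 : b n @[n --> \oo] --> (0 : R).
  rewrite -(mulr0 (theta ^+ 2 * expR `|theta|)); apply: cvgMr; exact: cvg_natrV.
have lo : theta - b n @[n --> \oo] --> theta.
  by rewrite -[X in _ --> X]subr0; apply: cvgB => //; exact: cvg_cst.
have hi : theta + b n @[n --> \oo] --> theta.
  by rewrite -[X in _ --> X]addr0; apply: cvgD => //; exact: cvg_cst.
apply: (squeeze_cvgr _ lo hi); near=> n.
have n0 : (0 < n)%N by near: n; exists 1%N.
have nR : 0 < n%:R :> R by rewrite ltr0n.
rewrite -ler_distlC; have := expR_sub1D_le (theta / n%:R).
rewrite -(ler_pM2l nR) -{1}(gtr0_norm nR) -normrM distrC.
rewrite (_ : n%:R * (_ - _) = n%:R * (expR (theta / n%:R) - 1) - theta).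
  move=> /le_trans; apply; rewrite /b.
  rewrite (_ : n%:R * _ = theta ^+ 2 * expR `|theta / n%:R| * n%:R^-1).
    rewrite ler_pM2r ?invr_gt0// ler_wpM2l ?sqr_ge0// ler_expR normrM normfV.
    by rewrite (gtr0_norm nR) ler_pdivrMr// ler_peMr// ler1n.
  by rewrite expr_div_n; field; rewrite gt_eqF.
by field; rewrite gt_eqF.
Unshelve. all: by end_near. Qed.

(** With c = n (e^(theta / n) - 1), which tends to theta, the exponent is the
    difference of Ein_n at c and at c e^(-mu t), and the contribution of the q0
    initial customers tends to 1. *)
Lemma cvg_queue_pgf t q0 :
  queue_pgf lam mu n (expR (theta / n%:R)) t q0 @[n --> \oo] -->
  expR (lam / mu * (Ein theta - Ein (theta * expR (- (mu * t))))).
Proof.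
pose u := expR (- (mu * t)); rewrite -/u.
pose z n := expR (theta / n%:R).
pose c n := n%:R * (z n - 1).
have E1 : Ein_n n (c n) - Ein_n n (c n * u) @[n --> \oo] -->
    Ein theta - Ein (theta * u).
  apply: cvgB; apply: cvg_Ein_n; first exact: cvg_scaled_slope.
  by apply: cvgMl; exact: cvg_scaled_slope.
have E2 : bernoulli_pgf mu (z n) t ^+ q0 @[n --> \oo] --> (1 : R).
  rewrite -[X in _ --> X](expr1n _ q0).
  apply: (continuous_cvg _ (@exprn_continuous R q0 1)).
  rewrite [X in _ --> X](_ : 1 = 1 + (1 - 1) * u :> R); last first.
    by rewrite subrr mul0r addr0.
  apply: cvgD; first exact: cvg_cst.
  by apply: cvgMl; apply: cvgB; [exact: cvg_expR_scaled|exact: cvg_cst].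
rewrite -[X in _ --> X]mul1r.
have E3 : expR (lam / mu * (Ein_n n (c n) - Ein_n n (c n * u))) @[n --> \oo] -->
    expR (lam / mu * (Ein theta - Ein (theta * u))).
  apply: (continuous_cvg _ (@continuous_expR R _)); exact: cvgMr.
apply: cvg_trans (cvgM E2 E3); apply: near_eq_cvg; near=> n.
have n0 : (0 < n)%N by near: n; exists 1%N.
have nR : n%:R != 0 :> R by rewrite pnatr_eq0 -lt0n.
rewrite /queue_pgf; congr (_ * expR (_ * _)).
rewrite /Ein_n -sumrB; apply: eq_bigr => k _; rewrite -mulrBl; congr (_ / _).
have -> : 1 + c n / n%:R = z n by rewrite /c; field.
have -> : 1 + c n * u / n%:R = bernoulli_pgf mu (z n) t.
  by rewrite /c /bernoulli_pgf -/u; field.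
by ring.
Unshelve. all: by end_near. Qed.

Lemma cvg_Ein_exp_decay :
  expR (lam / mu * (Ein theta - Ein (theta * expR (- (mu * t))))) @[t --> +oo]
  --> expR (lam / mu * Ein theta).
Proof.
apply: (continuous_cvg _ (@continuous_expR R _)); apply: cvgMr.
rewrite -[X in _ --> X]subr0; apply: cvgB; first exact: cvg_cst.
rewrite -(Ein0 R); apply: (continuous_cvg _ (@continuous_Ein R 0)).
rewrite -(mulr0 theta); apply: cvgMr.
have h : mu * t @[t --> +oo] --> +oo by apply: gt0_cvgMry => //; exact: cvg_id.
exact: (cvg_comp _ _ h (@cvgr_expR R)).
Qed.

(** In terms of Ein the three cases are one formula: the logarithm in the
    exponential integrals cancels the power of theta. *)
Lemma limit_mgf_Ein :
  (if 0 < theta then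
     theta `^ (- (lam / mu)) *
     expR (lam / mu * (Ei theta - euler_mascheroni R))
   else if theta < 0 then
     (- theta) `^ (- (lam / mu)) *
     expR (- (lam / mu) * (E1 (- theta) + euler_mascheroni R))
   else 1) = expR (lam / mu * Ein theta).
Proof.
have [t0|t0|<-] := ltgtP 0 theta; last by rewrite Ein0 mulr0 expR0.
  by rewrite /powR gt_eqF// -expRD Ei_Ein//; congr expR; ring.
have Nt0 : 0 < - theta by rewrite oppr_gt0.
rewrite /powR gt_eqF// -expRD E1_Ein// opprK; congr expR; ring.
Qed.

End limits.

Theorem corollary2p8 (R : realType) (lam mu : R) (hlam : 0 < lam)
    (hmu : 0 < mu) (q0 : nat)
    (d : nat -> measure_display) (T : forall n : nat, measurableType (d n))
    (P : forall n : nat, probability (T n) R)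
    (Q : forall n : nat, R -> {RV (P n) >-> nat})
    (hQ : forall n : nat, (0 < n)%N ->
      batch_infinite_server_queue lam mu n q0 (Q n))
    (theta : R) :
  exists M : R -> R,
    (forall t : R, 0 <= t ->
      mmt_gen_fun (P n) (fun w => (Q n t w)%:R / n%:R) theta @[n --> \oo]
        --> (M t)%:E) /\
    M t @[t --> +oo] -->
      (if 0 < theta then
         theta `^ (- (lam / mu)) *
         expR (lam / mu * (Ei theta - euler_mascheroni R))
       else if theta < 0 then
         (- theta) `^ (- (lam / mu)) *
         expR (- (lam / mu) * (E1 (- theta) + euler_mascheroni R))
       else 1).
Proof.
exists (fun t =>
  expR (lam / mu * (Ein theta - Ein (theta * expR (- (mu * t)))))).
split=> [t t0|]; last by rewrite limit_mgf_Ein; exact: cvg_Ein_exp_decay.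
have E : \forall n \near \oo,
    (queue_pgf lam mu n (expR (theta / n%:R)) t q0)%:E =
    mmt_gen_fun (P n) (fun w => (Q n t w)%:R / n%:R) theta.
  near=> n; have n0 : (0 < n)%N by near: n; exists 1%N.
  by rewrite (queue_mgf theta hlam hmu n0 (hQ n n0) t0).
apply: cvg_trans (near_eq_cvg E) _.
apply: cvg_EFin; first by near=> n.
exact: cvg_queue_pgf.
Unshelve. all: by end_near. Qed.
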